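(* Under the setting of the context, assume $(A,B)$ is controllable and $N\ge n$, and consider the relaxed MPC problem $$\hat J_N^*(x;\delta)=\min_{\mathbf u}\sum_{k=0}^{N-1}\hat\ell(x_k,u_k)+\hat F(x_N)\quad\text{s.t. }x_0=x,\ x_{k+1}=Ax_k+Bu_k,$$ with the (nonrelaxed) terminal cost $\hat F(x)=x^\top Px+\varepsilon B_f(x)$ (equal to $+\infty$ outside $\mathcal{X}_f^\circ$). Then, independently of the relaxation parameter $\delta>0$ (satisfying the admissibility condition in the context), the feedback $u(k)=\hat u_0^*(x(k))$ asymptotically stabilizes the origin of $x(k+1)=Ax(k)+Bu(k)$ for any initial condition $x(0)\in\mathbb{R}^n$.
   Context: System $x(k+1)=Ax(k)+Bu(k)$, $x\in\mathbb{R}^n$, $u\in\mathbb{R}^m$. Polytopes $\mathcal{X}=\{x:C_xx\le d_x\}$, $\mathcal{U}=\{u:C_uu\le d_u\}$ (compact), $d_x,d_u$ entrywise strictly positive; $C^i$ row $i$, $d^i$ entry $i$. Stage cost $\ell(x,u)=x^\top Qx+u^\top Ru$, $Q\succeq0$, $R\succ0$; $\varepsilon>0$. Relaxed barrier: $\delta>0$; relaxing function $\beta(\cdot;\delta)$ is $\beta_k(z;\delta)=\frac{k-1}{k}[(\frac{z-k\delta}{(k-1)\delta})^k-1]-\ln\delta$ ($k\ge2$ even) or $\beta_e(z;\delta)=\exp(1-z/\delta)-1-\ln\delta$; $\hat B(z)=-\ln z$ for $z>\delta$, $\beta(z;\delta)$ for $z\le\delta$. With $z_x^i(x)=-C_x^ix+d_x^i$,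 $\hat B_x=\sum_i\hat B_{x,i}$ where either $\hat B_{x,i}(x)=\hat B(z_x^i(x))+\ln d_x^i-C_x^ix/d_x^i$ (gradient recentering) or $\hat B_{x,i}(x)=(1+w_x^i)(\hat B(z_x^i(x))+\ln d_x^i)$ with $w_x\ge0$ and $\sum_i(1+w_x^i)(C_x^i)^\top/d_x^i=0$ (weight recentering); $\hat B_u$ analogously. Admissibility: $\hat B_x(0)=\hat B_u(0)=0$ and $\nabla\hat B_x(0)=\nabla\hat B_u(0)=0$. Nonrelaxed $B_x,B_u$: same formulas with $\hat B(z)$ replaced by $-\ln z$. $\hat\ell(x,u)=\ell(x,u)+\varepsilon\hat B_u(u)+\varepsilon\hat B_x(x)$. Ingredients: $K$ with $A_K=A+BK$ Schur; $\mathcal{X}_K=\{x\in\mathcal{X}:Kx\in\mathcal{U}\}$, $B_K(x)=B_x(x)+B_u(Kx)$; a symmetric $M\succeq0$ and a convex compact $\mathcal{N}\subset\mathcal{X}_K$, $0\in\mathcal{N}^\circ$, with $B_K(x)\le x^\top Mx$ on $\mathcal{N}$; $P\succ0$ solving $P=A_K^\top PA_K+K^\top RK+Q+\varepsilon M$; terminal set $\mathcal{X}_f$ convex compact with $0\in\mathcal{X}_f\subset\mathcal{N}$ and $A_Kx\in\mathcal{X}_f$ for $x\in\mathcal{X}_f$; $B_f:\mathcal{X}_f^\circ\to\mathbb{R}_{\ge0}$ a recentered barrier function for $\mathcal{X}_f$ (convex, $C^1$, $B_f(0)=0$, $B_f(x)\to\infty$ as $x\to\partial\mathcal{X}_f$)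 with $B_f(A_Kx)\le B_f(x)$ for $x\in\mathcal{X}_f^\circ$. *)

(* Defs.v *)
From HB Require Import structures.
From mathcomp Require Import all_boot all_order all_algebra.
From mathcomp Require Import all_classical all_reals all_analysis.
From mathcomp Require Import complex.

Set Implicit Arguments.
Unset Strict Implicit.
Unset Printing Implicit Defensive.

Import Order.TTheory GRing.Theory Num.Theory.
Import numFieldNormedType.Exports.

Local Open Scope classical_set_scope.
Local Open Scope ring_scope.

Section MPCDefs.
Variable R : realType.

Definition qf {n : nat} (Q : 'M[R]_n) (x : 'cV[R]_n) : R := (x^T *m Q *m x) ord0 ord0.

Definition psd {n : nat} (Q : 'M[R]_n) : Prop :=
  Q^T = Q /\ forall x : 'cV[R]_n, 0 <= qf Q x.
Definition pd {n : nat} (Q : 'M[R]_n) : Prop :=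
  Q^T = Q /\ forall x : 'cV[R]_n, x != 0 -> 0 < qf Q x.

Definition controllable {n m : nat} (A : 'M[R]_n) (B : 'M[R]_(n, m)) : Prop :=
  \rank (\mxrow_(k < n) (A ^+ k *m B)) = n.

Definition schur {n : nat} (A : 'M[R]_n) : Prop :=
  forall z : R[i], root (char_poly (map_mx (fun r : R => (r%:C)%C) A)) z -> `|z| < 1.

Definition polytope {p n : nat} (C : 'M[R]_(p, n)) (d : 'cV[R]_p) : set 'cV[R]_n :=
  [set x | forall i : 'I_p, (C *m x) i ord0 <= d i ord0].

Definition slack {p n : nat} (C : 'M[R]_(p, n)) (d : 'cV[R]_p) (x : 'cV[R]_n) (i : 'I_p) : R :=
  - (C *m x) i ord0 + d i ord0.

Definition cvx_set {n : nat} (S : set 'cV[R]_n) : Prop :=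
  forall x y, S x -> S y -> forall t : R, 0 <= t <= 1 -> S (t *: x + (1 - t) *: y).

Definition cvx_fun_on {n : nat} (S : set 'cV[R]_n) (f : 'cV[R]_n -> R) : Prop :=
  forall x y, S x -> S y -> forall t : R, 0 <= t <= 1 ->
    f (t *: x + (1 - t) *: y) <= t * f x + (1 - t) * f y.

Inductive relax_kind : Type := RPoly of nat | RExp.

Definition relax_ok (rk : relax_kind) : Prop :=
  match rk with RPoly k => (2 <= k)%N /\ ~~ odd k | RExp => True end.

Definition beta (rk : relax_kind) (delta z : R) : R :=
  match rk with
  | RPoly k => (k.-1%:R / k%:R) *
                 (((z - k%:R * delta) / (k.-1%:R * delta)) ^+ k - 1) - ln delta
  | RExp => expR (1 - z / delta) - 1 - ln delta
  end.

Definition Bhat (rk : relax_kind) (delta z : R) : R :=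
  if delta < z then - ln z else beta rk delta z.

Definition Blog (z : R) : R := - ln z.

Inductive recenter (p : nat) : Type := RGrad | RWeight of 'cV[R]_p.

Definition recenter_ok {p n : nat} (C : 'M[R]_(p, n)) (d : 'cV[R]_p) (rc : recenter p) : Prop :=
  match rc with
  | RGrad => True
  | RWeight w => (forall i : 'I_p, 0 <= w i ord0) /\
                 \sum_(i < p) ((1 + w i ord0) / d i ord0) *: (row i C)^T = 0
  end.

(* recentered (relaxed or not, depending on the scalar barrier b) polytope barrier *)
Definition rbarrier (b : R -> R) {p n : nat} (C : 'M[R]_(p, n)) (d : 'cV[R]_p)
  (rc : recenter p) (x : 'cV[R]_n) : R :=
  \sum_(i < p)
    match rc with
    | RGrad => b (slack C d x i) + ln (d i ord0) - (C *m x) i ord0 / d i ord0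
    | RWeight w => (1 + w i ord0) * (b (slack C d x i) + ln (d i ord0))
    end.

Fixpoint traj {n m : nat} (A : 'M[R]_n) (B : 'M[R]_(n, m)) (x : 'cV[R]_n)
  (u : nat -> 'cV[R]_m) (k : nat) : 'cV[R]_n :=
  match k with
  | 0 => x
  | k'.+1 => A *m traj A B x u k' + B *m u k'
  end.

Fixpoint closed_loop {n m : nat} (A : 'M[R]_n) (B : 'M[R]_(n, m))
  (kappa : 'cV[R]_n -> 'cV[R]_m) (x0 : 'cV[R]_n) (k : nat) : 'cV[R]_n :=
  match k with
  | 0 => x0
  | k'.+1 => let x := closed_loop A B kappa x0 k' in A *m x + B *m kappa x
  end.

Definition GAS {n m : nat} (A : 'M[R]_n) (B : 'M[R]_(n, m))
  (kappa : 'cV[R]_n -> 'cV[R]_m) : Prop :=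
  (forall e : R, 0 < e -> exists eta : R, 0 < eta /\
     forall x0 : 'cV[R]_n, `|x0| < eta -> forall k, `|closed_loop A B kappa x0 k| < e)
  /\ (forall x0 : 'cV[R]_n, closed_loop A B kappa x0 k @[k --> \oo] --> (0 : 'cV[R]_n)).

Definition stage_hat {n m px pu : nat} (Q : 'M[R]_n) (Rm : 'M[R]_m)
  (eps : R) (rk : relax_kind) (delta : R)
  (Cx : 'M[R]_(px, n)) (dx : 'cV[R]_px) (rcx : recenter px)
  (Cu : 'M[R]_(pu, m)) (du : 'cV[R]_pu) (rcu : recenter pu)
  (x : 'cV[R]_n) (u : 'cV[R]_m) : R :=
  qf Q x + qf Rm u + eps * rbarrier (Bhat rk delta) Cu du rcu u
    + eps * rbarrier (Bhat rk delta) Cx dx rcx x.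

Definition term_hat {n : nat} (P : 'M[R]_n) (eps : R) (Xf : set 'cV[R]_n)
  (Bf : 'cV[R]_n -> R) (x : 'cV[R]_n) : \bar R :=
  if x \in (interior Xf : set 'cV[R]_n) then (qf P x + eps * Bf x)%:E else +oo%E.

Definition J_hat {n m px pu : nat} (N : nat) (A : 'M[R]_n) (B : 'M[R]_(n, m))
  (Q : 'M[R]_n) (Rm : 'M[R]_m) (eps : R) (rk : relax_kind) (delta : R)
  (Cx : 'M[R]_(px, n)) (dx : 'cV[R]_px) (rcx : recenter px)
  (Cu : 'M[R]_(pu, m)) (du : 'cV[R]_pu) (rcu : recenter pu)
  (P : 'M[R]_n) (Xf : set 'cV[R]_n) (Bf : 'cV[R]_n -> R)
  (x : 'cV[R]_n) (u : nat -> 'cV[R]_m) : \bar R :=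
  ((\sum_(k < N) stage_hat Q Rm eps rk delta Cx dx rcx Cu du rcu
                   (traj A B x u k) (u k))%:E
   + term_hat P eps Xf Bf (traj A B x u N))%E.

End MPCDefs.

(* Main.v *)
Require Import Defs.
From HB Require Import structures.
From mathcomp Require Import all_boot all_order all_algebra.
From mathcomp Require Import all_classical all_reals all_analysis.
From mathcomp Require Import complex ring lra.
Import Order.TTheory GRing.Theory Num.Theory.
Import numFieldNormedType.Exports.
Local Open Scope classical_set_scope.
Local Open Scope ring_scope.

Set Implicit Arguments.
Unset Strict Implicit.
Unset Printing Implicit Defensive.

(** The relaxed scalar barrier lies strictly above each of its tangents, so the
relaxed polytope barrier is continuous and strictly convex along directions not
killed by [C]; compactness of the polytope makes [C] injective, and
admissibility (zero value and zero gradient at the origin) then makes the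
barrier positive definite with at least linear growth.  Hence the stage cost is
coercive in the input and positive definite in the state even though [Q] is only
semidefinite.  Controllability and [n <= N] make every state feasible, and since
[Bf] blows up at the boundary of [Xf] the sublevel sets of the cost are compact,
which gives minimizers.  The relaxed barrier is dominated by the logarithmic one,
so the Lyapunov equation for [P] gives the usual terminal decrease under [K]; the
optimal value is then a Lyapunov function of the closed loop, bounded by the
terminal cost near the origin. *)

(** * Strict tangent inequalities for the logarithm and for even powers *)

Lemma ln_lt_subr1 (R : realType) (x : R) : 0 < x -> x != 1 -> ln x < x - 1.
Proof.
move=> x0 x1; have lnx : ln x != 0 by rewrite ln_eq0.
by have := expR_gt1Dx lnx; rewrite lnK ?posrE// => ?; lra.
Qed.

Lemma Bernoulli_ge0 (R : realType) (w : R) (k : nat) :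
  0 <= w -> 1 + k.+1%:R * (w - 1) <= w ^+ k.+1.
Proof.
move=> w0; elim: k => [|k IH]; first by rewrite expr1 mul1r; lra.
rewrite exprS; apply: le_trans (ler_wpM2l w0 IH).
have k0 : 0 <= k%:R :> R by [].
have sq0 : 0 <= (w - 1) ^+ 2 by exact: sqr_ge0.
by rewrite -(natr1 k.+1) -(natr1 k); nra.
Qed.

(** For [w >= 0], peeling off one factor leaves a surplus proportional to [(w - 1)^2]. For [w < 0],
    evenness replaces [w] by [- w], where the bound is larger. *)
Lemma Bernoulli_gt (R : realType) (w : R) (k : nat) :
  ~~ odd k -> (2 <= k)%N -> w != 1 -> 1 + k%:R * (w - 1) < w ^+ k.
Proof.
move=> evk k2 w1; have k0 : 0 < k%:R :> R by rewrite ltr0n; case: k k2 {evk}.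
case: (leP 0 w) => w0.
  case: k evk k2 k0 => [|[|k]]// _ _ k0.
  rewrite exprS; apply: lt_le_trans (ler_wpM2l w0 (@Bernoulli_ge0 R w k w0)).
  have : 0 < (w - 1) ^+ 2 by rewrite exprn_even_gt0//= subr_eq0.
  have : 0 <= k%:R :> R by [].
  by rewrite -(natr1 k.+1) -(natr1 k); nra.
have -> : w ^+ k = (- w) ^+ k by rewrite exprNn -signr_odd (negbTE evk) mul1r.
have nw0 : 0 <= - w by lra.
case: k evk k2 k0 => [|k]// _ _ k0.
by apply: lt_le_trans (@Bernoulli_ge0 R (- w) k nw0); nra.
Qed.

(** Bernoulli at the ratio [u / v], multiplied by [v ^+ k]; [u] may have any sign. *)
Lemma exprn_tangent (R : realType) (u v : R) (k : nat) :
  ~~ odd k -> (2 <= k)%N -> 0 < v -> u != v ->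
  v ^+ k + k%:R * v ^+ k.-1 * (u - v) < u ^+ k.
Proof.
move=> evk k2 v0 uv.
have w1 : u / v != 1.
  by apply: contra uv => /eqP uv1; rewrite -(divfK (lt0r_neq0 v0) u) uv1 mul1r.
have := @Bernoulli_gt R (u / v) k evk k2 w1.
rewrite expr_div_n ltr_pdivlMr ?exprn_gt0//; apply: le_lt_trans.
case: k k2 {evk w1} => // k _ /=.
have -> : u / v - 1 = (u - v) / v by field; rewrite gt_eqF.
rewrite le_eqVlt; apply/orP; left; apply/eqP; rewrite exprS.
by field; rewrite gt_eqF.
Qed.

(** * The relaxed scalar barrier: slopes, tangents, comparison with the logarithm *)

(** Derivative of [Bhat]. For even [k] the sign is pulled out of the odd power [k.-1], leaving a
    base that is at least 1 on [z <= delta]. *)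
Definition bslope (R : realType) (rk : relax_kind) (delta z : R) : R :=
  if delta < z then - z^-1 else
  match rk with
  | RPoly k => - (((k%:R * delta - z) / (k.-1%:R * delta)) ^+ k.-1 / delta)
  | RExp => - (expR (1 - z / delta) / delta)
  end.

Section scalar_barrier.
Variables (R : realType) (rk : relax_kind) (delta : R).
Hypotheses (rk_ok : relax_ok rk) (delta0 : 0 < delta).

Lemma beta_delta : beta rk delta delta = - ln delta.
Proof.
have dn0 := lt0r_neq0 delta0.
case: rk rk_ok => [k [k2 evk]|_] /=; last by rewrite divff// subrr expR0; lra.
have k1 : k.-1%:R != 0 :> R by rewrite pnatr_eq0; case: k k2 {evk} => [|[|k]].
have -> : (delta - k%:R * delta) / (k.-1%:R * delta) = -1.
  have -> : k%:R = k.-1%:R + 1 :> R by rewrite natr1 prednK// ltnW.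
  by field; rewrite dn0 k1.
by rewrite -signr_odd (negbTE evk) expr0 subrr mulr0 sub0r.
Qed.

(** An even power allows flipping the sign of the base, which is then positive at [z], so
    [exprn_tangent] applies; the exponential case is [1 + t < expR t]. *)
Lemma beta_tangent (y z : R) : z <= delta -> y != z ->
  beta rk delta z + bslope rk delta z * (y - z) < beta rk delta y.
Proof.
move=> zd yz; rewrite /bslope (ltNge delta) zd /=.
have dn0 := lt0r_neq0 delta0.
case: rk rk_ok => [k [k2 evk]|_] /=.
  have k1 : 0 < k.-1%:R :> R by rewrite ltr0n; case: k k2 {evk} => [|[|k]].
  have kE : k%:R = k.-1%:R + 1 :> R by rewrite natr1 prednK// ltnW.
  have evN w : ((w - k%:R * delta) / (k.-1%:R * delta)) ^+ k =
               ((k%:R * delta - w) / (k.-1%:R * delta)) ^+ k.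
    by rewrite -opprB mulNr exprNn -signr_odd (negbTE evk) mul1r.
  rewrite !evN; set a := fun w => (k%:R * delta - w) / (k.-1%:R * delta).
  have az : 0 < a z.
    have kd0 := mulr_gt0 k1 delta0.
    by rewrite divr_gt0// subr_gt0 kE mulrDl mul1r; lra.
  have ayz : a y - a z = - (y - z) / (k.-1%:R * delta).
    by rewrite /a; field; rewrite dn0 gt_eqF.
  have ayz0 : a y != a z.
    rewrite -subr_eq0 ayz mulf_neq0 ?oppr_eq0 ?subr_eq0 ?invr_eq0//.
    by rewrite mulf_neq0// gt_eqF.
  have := @exprn_tangent R (a y) (a z) k evk k2 az ayz0.
  rewrite -/(a y) -/(a z) ayz => H.
  have c0 : 0 < k.-1%:R / k%:R :> R by rewrite divr_gt0// ltr0n ltnW.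
  have kn0 : k%:R != 0 :> R by rewrite pnatr_eq0 -lt0n ltnW.
  have k1n0 := lt0r_neq0 k1.
  rewrite -subr_gt0 in H; move: (mulr_gt0 c0 H) => {}H; rewrite -subr_gt0.
  apply: (lt_le_trans H); rewrite le_eqVlt; apply/orP; left; apply/eqP.
  move: (a y ^+ k) (a z ^+ k) (a z ^+ k.-1) => p q r.
  by field; rewrite dn0 kn0 k1n0.
have t0 : - ((y - z) / delta) != 0.
  by rewrite oppr_eq0 mulf_neq0 ?invr_eq0// subr_eq0.
have -> : 1 - y / delta = (1 - z / delta) + - ((y - z) / delta) by field.
have e0 := expR_gt0 (1 - z / delta).
rewrite (expRD (1 - z / delta)); have := expR_gt1Dx t0; set E := expR (1 - z / delta) in e0 *.
set f := expR _; move=> fE; have : E * (1 - (y - z) / delta) < E * f by rewrite ltr_pM2l.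
suff -> : E * (1 - (y - z) / delta) = E + - (E / delta) * (y - z) by lra.
by field.
Qed.

(** Both branches have slope [- delta^-1] at the junction; this bound and the next separate the
    slopes on its two sides, so that tangents can be glued. *)
Lemma bslope_ge (z : R) : z > delta -> - delta^-1 <= bslope rk delta z.
Proof. by move=> dz; rewrite /bslope dz lerN2 lef_pV2 ?posrE ?(lt_trans delta0 dz)// ltW. Qed.

Lemma bslope_le (z : R) : z <= delta -> bslope rk delta z <= - delta^-1.
Proof.
move=> zd; rewrite /bslope (ltNge delta) zd /=; have dn0 := lt0r_neq0 delta0.
case: rk rk_ok => [k [k2 evk]|_] /=; rewrite lerN2 ler_pdivlMr// mulVf//.
  have k1 : 0 < k.-1%:R :> R by rewrite ltr0n; case: k k2 {evk} => [|[|k]].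
  have kE : k%:R = k.-1%:R + 1 :> R by rewrite natr1 prednK// ltnW.
  apply: exprn_ege1; rewrite ler_pdivlMr ?mulr_gt0// kE; lra.
apply: le_trans (expR_ge1Dx _).
have : z / delta <= 1 by rewrite ler_pdivrMr// mul1r.
by lra.
Qed.

Lemma Nln_tangent (y z : R) : 0 < y -> 0 < z -> y != z ->
  - ln z + - z^-1 * (y - z) < - ln y.
Proof.
move=> y0 z0 yz; have zn0 := lt0r_neq0 z0.
have yz1 : y / z != 1.
  by apply: contra yz => /eqP yz1; rewrite -(divfK zn0 y) yz1 mul1r.
have := ln_lt_subr1 (divr_gt0 y0 z0) yz1; rewrite ln_div ?posrE//.
suff -> : - z^-1 * (y - z) = - (y / z - 1) by lra.
by field.
Qed.

(* Across the junction [delta], add the tangents at [delta] and at [z] and use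
   that the slope is monotone at [delta]. *)
Lemma Bhat_tangent (y z : R) : y != z ->
  Bhat rk delta z + bslope rk delta z * (y - z) < Bhat rk delta y.
Proof.
move=> yz; rewrite /Bhat; case: (ltP delta z) => dz; case: (ltP delta y) => dy.
- by rewrite /bslope dz; apply: Nln_tangent => //; exact: lt_trans delta0 _.
- have sz := bslope_ge dz; have bz : bslope rk delta z = - z^-1 by rewrite /bslope dz.
  have dz' : delta != z by rewrite lt_eqF.
  have z0 := lt_trans delta0 dz.
  have := Nln_tangent delta0 z0 dz'; rewrite -bz.
  case: (eqVneq y delta) => [->|yd]; first by rewrite beta_delta.
  have := beta_tangent (le_refl delta) yd; rewrite beta_delta.
  have := bslope_le (le_refl delta); nra.
- have sz := bslope_le dz.
  have yd : y != delta by rewrite gt_eqF.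
  have y0 := lt_trans delta0 dy.
  have := Nln_tangent y0 delta0 yd.
  case: (eqVneq z delta) => [zd|zd].
    by rewrite zd beta_delta in sz *; nra.
  have zd' : delta != z by rewrite eq_sym.
  have := beta_tangent dz zd'; rewrite beta_delta; nra.
- exact: beta_tangent.
Qed.

(** All from [1 + t <= expR t]: it gives [z / delta <= expR (z / delta - 1)] for the exponential
    slope, and bounds the size of the polynomial slope by the exponential one. *)
Lemma bslope_geNinv (z : R) : 0 < z -> z <= delta -> - z^-1 <= bslope rk delta z.
Proof.
move=> z0 zd; rewrite /bslope (ltNge delta) zd /=; have dn0 := lt0r_neq0 delta0.
have zn0 := lt0r_neq0 z0.
have expz : expR (1 - z / delta) / delta <= z^-1.
  have := expR_ge1Dx (z / delta - 1); rewrite addrC subrK => h.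
  have -> : 1 - z / delta = - (z / delta - 1) by lra.
  rewrite expRN -invfM lef_pV2 ?posrE ?mulr_gt0 ?expR_gt0//.
  by rewrite -ler_pdivrMr.
case: rk rk_ok => [k [k2 evk]|_] /=; rewrite lerN2//.
apply: le_trans expz; rewrite ler_pM2r ?invr_gt0//.
have k1 : 0 < k.-1%:R :> R by rewrite ltr0n; case: k k2 {evk} => [|[|k]].
have kE : k%:R = k.-1%:R + 1 :> R by rewrite natr1 prednK// ltnW.
have -> : (k%:R * delta - z) / (k.-1%:R * delta) = 1 + (1 - z / delta) / k.-1%:R.
  by rewrite kE; field; rewrite dn0 gt_eqF.
have -> : expR (1 - z / delta) = expR ((1 - z / delta) / k.-1%:R) ^+ k.-1.
  by rewrite -expRM_natr divfK// gt_eqF.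
apply: lerXn2r; rewrite ?nnegrE ?expR_ge0 ?expR_ge1Dx//.
have : z / delta <= 1 by rewrite ler_pdivrMr// mul1r.
by move=> ?; rewrite addr_ge0// divr_ge0//; lra.
Qed.

Lemma is_derive_beta (z : R) : z <= delta ->
  is_derive z 1 (beta rk delta) (bslope rk delta z).
Proof.
move=> zd; rewrite /bslope (ltNge delta) zd /=; have dn0 := lt0r_neq0 delta0.
case: rk rk_ok => [k [k2 evk]|_] /=.
  have k1 : 0 < k.-1%:R :> R by rewrite ltr0n; case: k k2 {evk} => [|[|k]].
  pose a w := (w - k%:R * delta) * (k.-1%:R * delta)^-1 : R.
  have da : is_derive z 1 a (k.-1%:R * delta)^-1.
    apply: is_derive_eq; rewrite scaler0 add0r subr0.
    by rewrite /GRing.scale /= mulr1.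
  have -> : beta (RPoly k) delta =
     (k.-1%:R / k%:R) *: (a ^+ k - cst 1) - cst (ln delta).
    by apply/funext => w; rewrite !fctE.
  apply: is_derive_eq.
  have -> : (k%:R * delta - z) / (k.-1%:R * delta) = - a z by rewrite /a -mulNr opprB.
  have kn0 : k%:R != 0 :> R by rewrite pnatr_eq0 -lt0n ltnW.
  have k1n0 := lt0r_neq0 k1.
  rewrite exprNn -signr_odd /GRing.scale /=.
  have -> : odd k.-1 = true by case: k k2 evk {k1 a da kn0 k1n0} => // k _ /= /negbNE.
  by move: (a z ^+ k.-1) => r; field; rewrite dn0 kn0 k1n0.
pose b w := 1 - w * delta^-1 : R.
have db : is_derive z 1 b (- delta^-1).
  apply: is_derive_eq; rewrite scaler0 !add0r.
  by rewrite /GRing.scale /= mul1r /GRing.scale /= mulr1.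
have deb := is_derive1_comp (is_derive_expR (b z)) db.
have -> : beta RExp delta = (expR \o b) - cst 1 - cst (ln delta).
  by apply/funext => w; rewrite !fctE.
by apply: is_derive_eq; rewrite !subr0 mulrN.
Qed.

(** Below [delta], the difference [- ln - beta] is nonincreasing by the slope comparison and
    vanishes at [delta]. *)
Lemma Bhat_le_Blog (z : R) : 0 < z -> Bhat rk delta z <= Blog z.
Proof.
move=> z0; rewrite /Bhat /Blog; case: ltP => // zd.
pose f w := - ln w - beta rk delta w.
have df w : 0 < w -> w <= delta -> is_derive w 1 f (- w^-1 - bslope rk delta w).
  move=> w0 wd; have dl := is_derive1_ln w0; have db := is_derive_beta wd.
  exact: is_deriveB.
suff : f delta <= f z by rewrite /f beta_delta; lra.
apply: (@ler0_derive1_le_cc _ f z delta).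
- by move=> w; rewrite in_itv /= => /andP[zw /ltW wd]; have [] := df w (lt_trans z0 zw) wd.
- move=> w; rewrite in_itv /= => /andP[zw /ltW wd].
  have w0 := lt_trans z0 zw; rewrite derive1E; have [_ ->] := df w w0 wd.
  by have := bslope_geNinv w0 wd; lra.
- apply: derivable_within_continuous => w; rewrite in_itv /= => /andP[zw wd].
  by have [] := df w (lt_le_trans z0 zw) wd.
- by rewrite in_itv /= zd lexx.
- by rewrite in_itv /= zd lexx.
- exact: zd.
Qed.

End scalar_barrier.

(** A global tangent inequality forces nondecreasing slopes, so near [z] they lie between
    [s (z - 1)] and [s (z + 1)], which makes [f] Lipschitz there. *)
Lemma tangent_continuous (R : realType) (f s : R -> R) :
  (forall y z, f z + s z * (y - z) <= f y) -> continuous f.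
Proof.
move=> tan z.
have smono y w : y <= w -> s y <= s w.
  rewrite le_eqVlt => /predU1P[->//|yw].
  by have := tan y w; have := tan w y; nra.
apply/cvgrPdist_lt => e e0.
(* Bounds all slopes on [[z - 1, z + 1]]; the summand 1 keeps it positive. *)
set L := `|s (z - 1)| + `|s (z + 1)| + 1.
have L0 : 0 < L by rewrite /L ltr_wpDl// addr_ge0.
near=> y.
have yz1 : `|z - y| < 1 by near: y; exact: cvgr_dist_lt.
have yzL : `|z - y| < e / L.
  by near: y; apply: cvgr_dist_lt => //; rewrite divr_gt0.
rewrite ltr_pdivlMr// in yzL; apply: le_lt_trans yzL.
move: yz1; rewrite ltr_norml => /andP[yz1 yz2].
have sz1 : s (z - 1) <= s y by apply: smono; lra.
have sz2 : s y <= s (z + 1) by apply: smono; lra.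
have sz3 : s (z - 1) <= s z by apply: smono; lra.
have sz4 : s z <= s (z + 1) by apply: smono; lra.
have bnd w : s (z - 1) <= w -> w <= s (z + 1) -> `|w| <= L.
  move=> h1 h2; rewrite /L ler_norml.
  have := ler_norm (s (z + 1)); have := ler_norm (- s (z - 1)); rewrite normrN.
  have := normr_ge0 (s (z + 1)); have := normr_ge0 (s (z - 1)).
  by move=> *; apply/andP; split; lra.
have prod w : `|w| <= L -> `|w * (z - y)| <= `|z - y| * L.
  by move=> wL; rewrite normrM mulrC ler_wpM2l.
have := prod _ (bnd _ sz1 sz2); have := prod _ (bnd _ sz3 sz4).
rewrite !ler_norml => /andP[p1 p2] /andP[p3 p4].
have := tan y z; have := tan z y.
by move=> *; apply/andP; split; lra.
Unshelve. all: by end_near. Qed.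

Lemma Bhat_continuous (R : realType) (rk : relax_kind) (delta : R) :
  relax_ok rk -> 0 < delta -> continuous (Bhat rk delta).
Proof.
move=> rk_ok delta0; apply: (tangent_continuous (s := bslope rk delta)) => y z.
case: (eqVneq y z) => [->|yz]; first by rewrite subrr mulr0 addr0.
exact/ltW/Bhat_tangent.
Qed.

(** * Entrywise limits and compactness for real matrices *)

Section matrix_topology.
Variable R : realType.

Lemma cvg_mx (m n : nat) (T : Type) (F : set_system T) {FF : Filter F}
    (f : T -> 'M[R]_(m, n)) (l : 'M[R]_(m, n)) :
  (forall i j, f x i j @[x --> F] --> l i j) -> f x @[x --> F] --> l.
Proof.
move=> fl A [P Pl PA].
have : \forall x \near F, forall ij : 'I_m * 'I_n, P ij.1 ij.2 (f x ij.1 ij.2).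
  by apply: filter_forall => -[i j] /=; exact: (fl i j _ (Pl i j)).
by apply: filterS => x Px; apply: PA => i j; exact: (Px (i, j)).
Qed.

Lemma cvg_coord (m n : nat) (T : Type) (F : set_system T) {FF : Filter F}
    (f : T -> 'M[R]_(m, n)) (l : 'M[R]_(m, n)) i j :
  f x @[x --> F] --> l -> f x i j @[x --> F] --> l i j.
Proof. by move=> fl; apply: (cvg_comp f (fun M => M i j) fl); exact: coord_continuous. Qed.

Lemma cvg_sumr (I : finType) (T : Type) (F : set_system T) {FF : Filter F}
    (f : I -> T -> R) (l : I -> R) :
  (forall i, f i x @[x --> F] --> l i) ->
  \sum_i f i x @[x --> F] --> \sum_i l i.
Proof.
move=> fl; apply: (@cvg_big _ _ +%R 0 xpredT) => //.
exact: add_continuous.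
Qed.

Lemma cvg_mulmx (m n p : nat) (T : Type) (F : set_system T) {FF : Filter F}
    (f : T -> 'M[R]_(m, n)) (g : T -> 'M[R]_(n, p)) (a : 'M[R]_(m, n)) (b : 'M[R]_(n, p)) :
  f x @[x --> F] --> a -> g x @[x --> F] --> b ->
  f x *m g x @[x --> F] --> a *m b.
Proof.
move=> fa gb; apply: cvg_mx => i j; rewrite mxE.
under eq_fun do rewrite mxE.
by apply: cvg_sumr => k; apply: cvgM; exact: cvg_coord.
Qed.

Lemma cvg_trmx (m n : nat) (T : Type) (F : set_system T) {FF : Filter F}
    (f : T -> 'M[R]_(m, n)) (a : 'M[R]_(m, n)) :
  f x @[x --> F] --> a -> (f x)^T @[x --> F] --> a^T.
Proof.
move=> fa; apply: cvg_mx => i j; rewrite mxE.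
under eq_fun do rewrite mxE.
exact: cvg_coord.
Qed.

Lemma cvg_qf (n : nat) (T : Type) (F : set_system T) {FF : Filter F}
    (Q : 'M[R]_n) (f : T -> 'cV[R]_n) (a : 'cV[R]_n) :
  f x @[x --> F] --> a -> qf Q (f x) @[x --> F] --> qf Q a.
Proof.
move=> fa; rewrite /qf; apply: cvg_coord.
by apply: cvg_mulmx => //; apply: cvg_mulmx; [exact: cvg_trmx|exact: cvg_cst].
Qed.

Lemma coord_le_mx_norm (m n : nat) (U : 'M[R]_(m, n)) i j : `|U i j| <= `|U|.
Proof.
rewrite [leRHS]/Num.Def.normr /= mx_normrE; apply/bigmax_geP; right.
by exists (i, j).
Qed.

Lemma mx_norm_le (m n : nat) (U : 'M[R]_(m, n)) (c : R) :
  0 <= c -> (forall i j, `|U i j| <= c) -> `|U| <= c.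
Proof.
move=> c0 Uc; rewrite [leLHS]/Num.Def.normr /= mx_normrE.
by apply/bigmax_leP; split => // -[i j] _; exact: Uc.
Qed.

(** Heine-Borel for row vectors, transported along the continuous map [vec_mx]. *)
Lemma mx_compact (m n : nat) (A : set 'M[R]_(m, n)) :
  bounded_set A -> closed A -> compact A.
Proof.
move=> bA cA.
have cvec : continuous (@vec_mx R m n).
  move=> v; apply: (@cvg_mx _ _ _ (nbhs v)) => i j; rewrite mxE.
  under eq_fun do rewrite mxE.
  exact: coord_continuous.
have -> : A = vec_mx @` (@vec_mx R m n @^-1` A).
  apply/seteqP; split => [x Ax|_ [v Av <-]]//.
  by exists (mxvec x) => /=; rewrite mxvecK.
apply: continuous_compact; first exact: continuous_subspaceT.
apply: bounded_closed_compact; last first.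
  by apply: preimage_closed cA => v _; exact: cvec.
case: bA => M [Mr bM]; exists M; split => // x /bM h v /h.
move=> /= vx; apply: mx_norm_le => [|i k]; first exact: le_trans (normr_ge0 _) vx.
case/mxvec_indexP: k => a b; apply: le_trans vx.
by apply: le_trans (coord_le_mx_norm _ a b); rewrite mxE ord1.
Qed.

End matrix_topology.

(** * Growth of positive definite functions star-convex at the origin *)

Section growth.
Variables (R : realType) (n : nat) (phi : 'cV[R]_n -> R).
Hypotheses (phi_cont : continuous phi) (phi_pos : forall x : 'cV[R]_n, x != 0 -> 0 < phi x).
Hypothesis phi_star : forall (x : 'cV[R]_n) (t : R), 0 <= t <= 1 -> phi (t *: x) <= t * phi x.

(** On the compact sphere of radius [e], [phi] has a positive minimum; shrinking [x] radially onto
    the sphere and using [phi_star] carries the bound outwards. *)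
Lemma posdef_linear_growth (e : R) : 0 < e ->
  exists2 c : R, 0 < c & forall x : 'cV[R]_n, e <= `|x| -> c * `|x| <= phi x.
Proof.
move=> e0; pose S := [set x : 'cV[R]_n | `|x| = e].
have cS : compact S.
  apply: mx_compact.
    by exists e; split => [|M eM x /= ->]; [exact: num_real|exact: ltW].
  have -> : S = (fun x : 'cV[R]_n => `|x|) @^-1` [set e] by [].
  by apply: preimage_closed; [move=> x _; exact: norm_continuous|exact: closed_eq].
have proj (x : 'cV[R]_n) : e <= `|x| -> S ((e / `|x|) *: x) /\ 0 <= e / `|x| <= 1.
  move=> ex; have x0 : 0 < `|x| by exact: lt_le_trans ex.
  split; last by rewrite divr_ge0 ?(ltW e0)//= ler_pdivrMr// mul1r.
  by rewrite /S /= normrZ ger0_norm ?divr_ge0 ?(ltW e0)// divfK// gt_eqF.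
(* If the sphere is empty (dimension zero), no [x] has norm at least [e]. *)
have [[x0 Sx0]|S0] := pselect (S !=set0); last first.
  by exists 1 => // x ex; case: S0; exists ((e / `|x|) *: x); exact: (proj x ex).1.
have [x1] := compact_EVT_min (ex_intro _ x0 Sx0) cS (continuous_subspaceT phi_cont).
rewrite inE => Sx1 minx1.
have phix1 : 0 < phi x1 by apply: phi_pos; rewrite -normr_gt0 Sx1.
exists (phi x1 / e); first by rewrite divr_gt0.
move=> x ex; have [Sx t01] := proj x ex.
have x_gt0 : 0 < `|x| by exact: lt_le_trans ex.
have := le_trans (minx1 _ (mem_set Sx)) (phi_star x t01).
rewrite mulrAC ler_pdivlMr// => h.
by rewrite mulrAC ler_pdivrMr// [phi x * _]mulrC.
Qed.

End growth.

(** For [h > 0] the difference quotient is at least [L], while it tends to the derivative 0. *)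
Lemma derive0_tangent (R : realType) (n : nat) (f : 'cV[R]_n -> R)
    (v : 'cV[R]_n) (L : R) :
  f 0 = 0 -> is_derive 0 v f 0 -> (forall h, h * L <= f (h *: v)) -> L <= 0.
Proof.
move=> f0 [dv dE] tan; rewrite leNgt; apply/negP => L0.
have : h^-1 *: (f (h *: v + 0) - f 0) @[h --> 0^'] --> (0 : R).
  by rewrite -[X in _ --> X]dE; exact: dv.
move/cvg_dnbhs_at_right/cvgrPdist_lt => /(_ L L0) H.
near (0 : R)^'+ => h.
have h0 : 0 < h by near: h; exact: nbhs_right_gt.
have : `|0 - h^-1 *: (f (h *: v + 0) - f 0)| < L by near: h.
rewrite addr0 f0 subr0 sub0r normrN; apply/negP; rewrite -leNgt.
apply: le_trans (ler_norm _); rewrite /GRing.scale /= mulrC ler_pdivlMr//.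
by rewrite mulrC.
Unshelve. all: by end_near. Qed.

(** * The recentered relaxed barrier of a polytope *)

Section polytope_barrier.
Variables (R : realType) (p n : nat) (C : 'M[R]_(p, n)) (d : 'cV[R]_p).
Variables (rc : recenter R p) (rk : relax_kind) (delta : R).
Hypotheses (d0 : forall i, 0 < d i ord0) (rk_ok : relax_ok rk).
Hypotheses (rc_ok : recenter_ok C d rc) (delta0 : 0 < delta).

Let Phi := rbarrier (Bhat rk delta) C d rc.

(** Since [d] is positive, the whole line through 0 along a kernel vector lies in the polytope,
    against boundedness. *)
Lemma polytope_ker : compact (polytope C d) -> forall x : 'cV[R]_n, C *m x = 0 -> x = 0.
Proof.
move=> /compact_bounded[M [Mr bM]] x Cx0; apply/eqP; apply: contraT => x0.
have nx : 0 < `|x| by rewrite normr_gt0.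
have inP t : polytope C d (t *: x).
  by move=> i; rewrite -scalemxAr Cx0 scaler0 mxE ltW.
have M1 : M < `|M| + 1 by have := ler_norm M; lra.
have := bM (`|M| + 1) M1 _ (inP ((`|M| + 2) / `|x|)).
rewrite /= normrZ ger0_norm ?divr_ge0 ?addr_ge0// divfK ?gt_eqF//.
by lra.
Qed.

(** Weights giving both recenterings one common form; [lin] carries the gradient correction. *)
Let wgt i : R := if rc is RWeight w then 1 + w i ord0 else 1.

Let lin i : R := if rc is RWeight w then 0 else (d i ord0)^-1.

Let wgt_gt0 i : 0 < wgt i.
Proof.
rewrite /wgt; case: rc rc_ok => [//|w [w0 _]]; by have := w0 i; lra.
Qed.

Lemma rbarrierE (b : R -> R) x : rbarrier b C d rc x =
  \sum_i (wgt i * (b (slack C d x i) + ln (d i ord0)) - lin i * (C *m x) i ord0).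
Proof.
apply: eq_bigr => i _; rewrite /wgt /lin; case: rc => [|w].
  by rewrite mul1r [_ / _]mulrC.
by rewrite mul0r subr0.
Qed.

(** Gradient of [Phi] at [z] with respect to [C *m x]; the slack decreases in [C *m x], hence the
    sign. *)
Let gradc (z : 'cV[R]_n) i := - (wgt i * bslope rk delta (slack C d z i)) - lin i.

Lemma slackB (x z : 'cV[R]_n) i :
  slack C d x i - slack C d z i = - (C *m (x - z)) i ord0.
Proof. by rewrite /slack mulmxBr !mxE; lra. Qed.

(** Scalar tangents are summed with positive weights; a row separating [x] from [z] gives
    strictness. *)
Lemma rbarrier_tangent (x z : 'cV[R]_n) : C *m (x - z) != 0 ->
  Phi z + \sum_i gradc z i * (C *m (x - z)) i ord0 < Phi x.
Proof.
move=> Cxz; rewrite /Phi !rbarrierE -big_split /=.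
have term i : (C *m (x - z)) i ord0 != 0 ->
  wgt i * (Bhat rk delta (slack C d z i) + ln (d i ord0)) - lin i * (C *m z) i ord0
  + gradc z i * (C *m (x - z)) i ord0 <
  wgt i * (Bhat rk delta (slack C d x i) + ln (d i ord0)) - lin i * (C *m x) i ord0.
  move=> ci; have sxz : slack C d x i != slack C d z i.
    by rewrite -subr_eq0 slackB oppr_eq0.
  have := Bhat_tangent rk_ok delta0 sxz; rewrite slackB -(ltr_pM2l (wgt_gt0 i)).
  have -> : (C *m x) i ord0 = (C *m z) i ord0 + (C *m (x - z)) i ord0.
    by rewrite mulmxBr !mxE; lra.
  rewrite /gradc; lra.
have [i ci] : exists i, (C *m (x - z)) i ord0 != 0.
  apply/existsP; apply: contraR Cxz; rewrite negb_exists => /forallP c0.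
  by apply/eqP/colP => i; rewrite [RHS]mxE; have /negbNE/eqP := c0 i.
rewrite (bigD1 i)//= [ltRHS](bigD1 i)//=; apply: ltr_leD; first exact: term.
apply: ler_sum => j _; case: (eqVneq ((C *m (x - z)) j ord0) 0) => [cj|/term/ltW//].
rewrite cj mulr0 addr0; have := slackB x z j; rewrite cj oppr0 => /eqP.
rewrite subr_eq0 => /eqP ->.
suff -> : (C *m x) j ord0 = (C *m z) j ord0 by [].
by move: cj; rewrite mulmxBr !mxE; lra.
Qed.

Lemma rbarrier_tangent_le (x z : 'cV[R]_n) :
  Phi z + \sum_i gradc z i * (C *m (x - z)) i ord0 <= Phi x.
Proof.
have [cxz|/rbarrier_tangent/ltW//] := eqVneq (C *m (x - z)) 0.
rewrite cxz big1 => [|i _]; last by rewrite mxE mulr0.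
rewrite addr0 /Phi !rbarrierE; rewrite le_eqVlt; apply/orP; left; apply/eqP.
apply: eq_bigr => i _.
have CE : C *m x = C *m z by apply/eqP; rewrite -subr_eq0 -mulmxBr cxz.
by rewrite /slack CE.
Qed.

Lemma rbarrier_continuous : continuous Phi.
Proof.
move=> x; have -> : Phi = fun y => \sum_i (wgt i * (Bhat rk delta (slack C d y i) +
    ln (d i ord0)) - lin i * (C *m y) i ord0).
  by apply/funext => y; rewrite /Phi rbarrierE.
have cC i : (C *m (y : 'cV[R]_n)) i ord0 @[y --> x] --> (C *m x) i ord0.
  exact: (cvg_coord (cvg_mulmx (cvg_cst C) (@cvg_id _ (nbhs x)))).
have cS i : slack C d y i @[y --> x] --> slack C d x i.
  exact: (cvgD (cvgN (cC i)) (cvg_cst _)).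
have cB i := cvg_comp _ _ (cS i) (@Bhat_continuous _ _ _ rk_ok delta0 (slack C d x i)).
apply: (@cvg_sumr _ _ _ (nbhs x)) => i.
exact: (cvgB (cvgM (cvg_cst _) (cvgD (cB i) (cvg_cst _))) (cvgM (cvg_cst _) (cC i))).
Qed.

Lemma rbarrier_le_Blog (x : 'cV[R]_n) :
  (forall i, 0 < slack C d x i) -> Phi x <= rbarrier (@Blog R) C d rc x.
Proof.
move=> sx; rewrite /Phi !rbarrierE; apply: ler_sum => i _.
by rewrite lerD2r ler_pM2l// lerD2r Bhat_le_Blog.
Qed.

Hypothesis Phi0 : Phi 0 = 0.
Hypothesis dPhi0 : forall v : 'cV[R]_n, is_derive 0 v Phi 0.

(** The tangent at [t *: x] is evaluated at [x] and at [0]; with weights [t] and [1 - t] the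
    gradient terms cancel. *)
Lemma rbarrier_star (x : 'cV[R]_n) (t : R) : 0 <= t <= 1 -> Phi (t *: x) <= t * Phi x.
Proof.
move=> /andP[t0 t1].
have := rbarrier_tangent_le x (t *: x); have := rbarrier_tangent_le 0 (t *: x).
set g := gradc _; rewrite Phi0.
have -> : x - t *: x = (1 - t) *: x by rewrite scalerBl scale1r.
rewrite sub0r -scaleNr; set G := \sum_i g i * (C *m x) i ord0.
have lG (c : R) : \sum_i g i * (C *m (c *: x)) i ord0 = c * G.
  by rewrite mulr_sumr; apply: eq_bigr => i _; rewrite -scalemxAr mxE mulrCA.
rewrite !lG; nra.
Qed.

(** The tangent at 0 is strict because [C] is injective, and its linear term [G] is nonnegative
    because the derivative of [Phi] vanishes there. *)
Lemma rbarrier_pos : compact (polytope C d) ->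
  forall x : 'cV[R]_n, x != 0 -> 0 < Phi x.
Proof.
move=> cP x x0.
have Cx0 : C *m (x - 0) != 0.
  by rewrite subr0; apply: contra x0 => /eqP/(polytope_ker cP) ->.
have := rbarrier_tangent Cx0; rewrite subr0 Phi0 add0r.
set G := \sum_i gradc 0 i * (C *m x) i ord0.
have lG (c : R) : \sum_i gradc 0 i * (C *m (c *: x)) i ord0 = c * G.
  by rewrite mulr_sumr; apply: eq_bigr => i _; rewrite -scalemxAr mxE mulrCA.
suff : - G <= 0 by lra.
(* [derive0_tangent] bounds a slope from above, so the direction is [- x], with slope [- G]. *)
apply: (derive0_tangent Phi0 (dPhi0 (- x))) => h.
have := rbarrier_tangent_le (h *: - x) 0.
by rewrite subr0 Phi0 add0r scalerN -scaleNr lG; lra.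
Qed.

Lemma rbarrier_ge0 : compact (polytope C d) -> forall x : 'cV[R]_n, 0 <= Phi x.
Proof.
move=> cP x; case: (eqVneq x 0) => [->|x0]; first by rewrite Phi0.
exact/ltW/rbarrier_pos.
Qed.

End polytope_barrier.

(** * An abstract MPC problem with stage cost [l] and terminal cost [F] on [D] *)

Section mpc.
Variables (R : realType) (n m N : nat) (A : 'M[R]_n) (B : 'M[R]_(n, m)).
Variables (l : 'cV[R]_n -> 'cV[R]_m -> R) (D : set 'cV[R]_n) (F : 'cV[R]_n -> R).

Lemma eq_traj (x : 'cV[R]_n) (u v : nat -> 'cV[R]_m) k :
  (forall j, (j < k)%N -> u j = v j) -> traj A B x u k = traj A B x v k.
Proof.
elim: k => [//|k IH] uv /=; rewrite uv// IH// => j jk.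
by apply: uv; exact: ltnW.
Qed.

Lemma traj_shift (x : 'cV[R]_n) (u : nat -> 'cV[R]_m) k :
  traj A B x u k.+1 = traj A B (A *m x + B *m u 0%N) (fun j => u j.+1) k.
Proof. by elim: k => [//|k IH]; rewrite [LHS]/= -/(traj A B x u k.+1) IH. Qed.

Definition rcost (x : 'cV[R]_n) (u : nat -> 'cV[R]_m) : R :=
  \sum_(k < N) l (traj A B x u k) (u k) + F (traj A B x u N).

(** Shaped so that [J_hat] is an instance by unfolding. *)
Definition mpc_cost (x : 'cV[R]_n) (u : nat -> 'cV[R]_m) : \bar R :=
  ((\sum_(k < N) l (traj A B x u k) (u k))%:E +
   (if traj A B x u N \in D then (F (traj A B x u N))%:E else +oo))%E.

Lemma mpc_costE x u :
  mpc_cost x u = if traj A B x u N \in D then (rcost x u)%:E else +oo%E.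
Proof. by rewrite /mpc_cost; case: ifP => _; rewrite ?EFinD. Qed.

Lemma eq_rcost (x : 'cV[R]_n) (u v : nat -> 'cV[R]_m) :
  (forall j, (j < N)%N -> u j = v j) -> rcost x u = rcost x v.
Proof.
move=> uv; congr (_ + F _); last exact: eq_traj.
apply: eq_bigr => k _; rewrite uv//; congr (l _ _).
by apply: eq_traj => j jk; apply: uv; exact: ltn_trans jk _.
Qed.

Hypothesis l_ge0 : forall x u, 0 <= l x u.
Hypothesis F_ge0 : forall x, D x -> 0 <= F x.
Hypothesis feasible : forall x, exists u, D (traj A B x u N).

(** * Existence of minimizers *)

Section existence.
Hypothesis l_cont : continuous (fun z : 'cV[R]_n * 'cV[R]_m => l z.1 z.2).
Hypothesis l_coercive : exists2 c : R, 0 < c &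
  forall (x : 'cV[R]_n) (u : 'cV[R]_m), 1 <= `|u| -> c * `|u| <= l x u.
Hypothesis F_cont : forall x, D x -> {for x, continuous F}.
Hypothesis F_barrier : forall y, ~ D y -> forall b : R,
  \forall x \near y, D x -> b < F x.

(** The cost reads only the first [N] inputs, so they are stored as matrix columns; later inputs
    default to 0. *)
Let useq (U : 'M[R]_(m, N)) (k : nat) : 'cV[R]_m :=
  if insub k is Some j then col j U else 0.

Let useq_cont k : continuous (useq^~ k).
Proof.
move=> U; rewrite /useq; case: (insub k : option 'I_N) => [j|]; last exact: cst_continuous.
apply: (@cvg_mx _ _ _ _ (nbhs U)) => i i'; rewrite mxE.
under eq_fun do rewrite mxE.
exact: coord_continuous.
Qed.

Let traj_cont x k : continuous (fun U => traj A B x (useq U) k).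
Proof.
elim: k => [|k IH] U /=; first exact: cst_continuous.
have cA : A *m traj A B x (useq V) k @[V --> U] --> A *m traj A B x (useq U) k.
  exact: cvg_mulmx (cvg_cst A) (IH U).
have cB : B *m useq V k @[V --> U] --> B *m useq U k.
  exact: cvg_mulmx (cvg_cst B) (@useq_cont k U).
exact: (cvgD cA cB).
Qed.

Let stage_cont x k : continuous (fun U => l (traj A B x (useq U) k) (useq U k)).
Proof.
move=> U.
exact: (cvg_comp _ _ (cvg_pair (@traj_cont x k U) (@useq_cont k U)) (@l_cont (_, _))).
Qed.

Let rcost_cont x U : D (traj A B x (useq U) N) ->
  {for U, continuous (fun V => rcost x (useq V))}.
Proof.
move=> DU; apply: (@cvgD _ _ _ (nbhs U)).
  apply: (@cvg_sumr _ _ _ (nbhs U)) => k; exact: stage_cont.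
exact: (cvg_comp _ _ (@traj_cont x N U) (F_cont DU)).
Qed.

Let sublevel x c := [set U | D (traj A B x (useq U) N) /\ rcost x (useq U) <= c].

Let rcost_geF x u : F (traj A B x u N) <= rcost x u.
Proof. by rewrite /rcost lerDr sumr_ge0. Qed.

(** At a feasible limit the cost is continuous; at an infeasible one [F_barrier] pushes the cost of
    nearby feasible inputs above [c]. *)
Let sublevel_closed x c : closed (sublevel x c).
Proof.
move=> U clU; have [DU|nDU] := pselect (D (traj A B x (useq U) N)).
  split => //; rewrite leNgt; apply/negP => cU.
  have [V [[DV Vc]]] : sublevel x c `&` [set V | c < rcost x (useq V)] !=set0.
    by apply: clU; apply: (cvgr_gt _ (rcost_cont DU)).
  by rewrite /= ltNge Vc.
have [V [[DV Vc] cV]] : sublevel x c `&`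
    [set V | D (traj A B x (useq V) N) -> c < F (traj A B x (useq V) N)] !=set0.
  by apply: clU; exact: (@traj_cont x N U _ (F_barrier nDU c)).
by have := lt_le_trans (cV DV) (rcost_geF x (useq V)); rewrite ltNge Vc.
Qed.

Let sublevel_bounded x c : bounded_set (sublevel x c).
Proof.
(* Covers both kinds of column: norm at most 1, or norm at least 1 and then at most [|c| / a] by
   coercivity. *)
case: l_coercive => a a0 la; exists (1 + `|c| / a); split; first exact: num_real.
move=> M cM U [DU Uc] /=; apply: le_trans (ltW cM).
have M0 : 0 <= 1 + `|c| / a by rewrite addr_ge0// divr_ge0// ltW.
apply: mx_norm_le => // i j.
have colU : `|U i j| <= `|col j U|.
  by apply: le_trans (coord_le_mx_norm _ i ord0); rewrite mxE.
apply: (le_trans colU); case: (leP 1 `|col j U|) => [U1|/ltW U1]; last first.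
  by apply: le_trans U1 _; rewrite lerDl divr_ge0// ltW.
suff : `|col j U| <= `|c| / a by move/le_trans; apply; rewrite lerDr.
rewrite ler_pdivlMr// mulrC.
apply: (le_trans (la (traj A B x (useq U) j) _ U1)).
apply: le_trans (le_trans Uc (ler_norm c)).
have -> : col j U = useq U j by rewrite /useq valK.
rewrite /rcost (bigD1 j)//= -addrA lerDl addr_ge0 ?sumr_ge0//.
exact: F_ge0.
Qed.

(** The cost of one feasible input fixes a compact sublevel set; inputs outside it are infeasible or
    cost more. *)
Lemma mpc_min_exists x : exists u, (mpc_cost x u < +oo)%E /\
  forall v, (mpc_cost x u <= mpc_cost x v)%E.
Proof.
pose mxu (u : nat -> 'cV[R]_m) : 'M[R]_(m, N) := \matrix_(i, j) u j i ord0.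
have mxuE u k : (k < N)%N -> useq (mxu u) k = u k.
  move=> kN; rewrite /useq insubT /=; apply/colP => i.
  by rewrite !mxE.
have [u0 Du0] := feasible x.
set c := rcost x u0.
have Su0 : sublevel x c (mxu u0).
  split; first by rewrite (eq_traj x (mxuE u0)).
  by rewrite (eq_rcost x (mxuE u0)).
have cS := mx_compact (@sublevel_bounded x c) (@sublevel_closed x c).
have wc : {within sublevel x c, continuous (fun V => rcost x (useq V))}.
  by apply: continuous_in_subspaceT => U /set_mem [DU _]; exact: rcost_cont.
have [U SU minU] := compact_EVT_min (ex_intro _ _ Su0) cS wc.
have [DU Uc] := set_mem SU.
exists (useq U); rewrite mpc_costE mem_set//; split; first exact: ltry.
move=> v; rewrite mpc_costE; case: ifPn => [/set_mem Dv|_]; last exact: leey.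
rewrite lee_fin; case: (leP (rcost x v) c) => [vc|/ltW]; last exact: le_trans.
rewrite -(eq_rcost x (mxuE v)); apply: minU; apply/mem_set; split.
  by rewrite (eq_traj x (mxuE v)).
by rewrite (eq_rcost x (mxuE v)).
Qed.

End existence.

(** * Lyapunov stability of the closed loop *)

Section stability.
Variable K : 'M[R]_(m, n).
Let AK := A + B *m K.
Hypothesis N_gt0 : (0 < N)%N.
Hypothesis l_pos : forall e : R, 0 < e -> exists2 c : R, 0 < c &
  forall (x : 'cV[R]_n) (u : 'cV[R]_m), e <= `|x| -> c <= l x u.
Hypothesis D0 : nbhs (0 : 'cV[R]_n) D.
Hypothesis F_cont0 : {for (0 : 'cV[R]_n), continuous F}.
Hypothesis F0 : F 0 = 0.
Hypothesis terminal : forall x, D x ->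
  D (AK *m x) /\ l x (K *m x) + F (AK *m x) <= F x.

Variable us : 'cV[R]_n -> nat -> 'cV[R]_m.
Hypothesis us_opt : forall x v, (mpc_cost x (us x) <= mpc_cost x v)%E.

Let V x := rcost x (us x).

Let us_feasible x : D (traj A B x (us x) N).
Proof.
have [u Du] := feasible x; have := us_opt x u.
by rewrite !mpc_costE (mem_set Du); case: ifPn => [/set_mem//|_]; rewrite leye_eq.
Qed.

Let V_le x v : D (traj A B x v N) -> V x <= rcost x v.
Proof.
move=> Dv; have := us_opt x v.
by rewrite !mpc_costE (mem_set Dv) (mem_set (us_feasible x)) lee_fin.
Qed.

Let V_ge0 x : 0 <= V x.
Proof. by rewrite addr_ge0 ?sumr_ge0//; apply: F_ge0; exact: us_feasible. Qed.

Let V_ge_stage x : l x (us x 0%N) <= V x.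
Proof.
rewrite /V /rcost; case: N N_gt0 (us_feasible x) => // N' _ DN.
by rewrite big_ord_recl /= -addrA lerDl addr_ge0 ?sumr_ge0//; exact: F_ge0.
Qed.

(* Shift the optimal input and append the terminal feedback. *)
Let V_decrease x : V (A *m x + B *m us x 0%N) <= V x - l x (us x 0%N).
Proof.
pose xN := traj A B x (us x) N.
pose v k := if (k.+1 < N)%N then us x k.+1 else K *m xN.
have trv k : (k < N)%N -> traj A B (A *m x + B *m us x 0%N) v k = traj A B x (us x) k.+1.
  move=> kN; rewrite traj_shift; apply: eq_traj => j jk.
  by rewrite /v (leq_ltn_trans jk kN).
have [N' NE] : exists N', N = N'.+1 by exists N.-1; rewrite prednK.
have vlast : v N' = K *m xN by rewrite /v NE ltnn.
have trN' : traj A B (A *m x + B *m us x 0%N) v N' = xN.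
  by rewrite trv ?NE// /xN NE.
have trvN : traj A B (A *m x + B *m us x 0%N) v N = AK *m xN.
  by rewrite [in LHS]NE /= vlast trN' /AK mulmxDl mulmxA.
have [DN decN] := terminal (us_feasible x).
have := @V_le (A *m x + B *m us x 0%N) v.
rewrite trvN => /(_ DN) /le_trans; apply.
have sumr (g : nat -> R) : \sum_(k < N) g k = \sum_(k < N') g k + g N'.
  by rewrite NE big_ord_recr.
have suml (g : nat -> R) : \sum_(k < N) g k = g 0%N + \sum_(k < N') g k.+1.
  by rewrite NE big_ord_recl.
rewrite /V /rcost trvN (sumr (fun k => l (traj A B _ v k) (v k))).
rewrite (suml (fun k => l (traj A B x _ k) (us x k))) trN' vlast.
have -> : \sum_(k < N') l (traj A B (A *m x + B *m us x 0%N) v k) (v k) =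
          \sum_(k < N') l (traj A B x (us x) k.+1) (us x k.+1).
  apply: eq_bigr => k _; rewrite trv ?NE ?leqW// /v NE ltnS ltn_ord//.
by move: decN; rewrite -/xN -[traj A B x _ 0]/x; lra.
Qed.

(** The feedback [K] generates a feasible input along which the terminal inequality telescopes. *)
Let V_le_terminal x : D x -> V x <= F x.
Proof.
move=> Dx; pose z k := iter k (mulmx AK) x.
have Dz k : D (z k) by elim: k => //= k /terminal[].
have trz k : traj A B x (fun j => K *m z j) k = z k.
  by elim: k => //= k ->; rewrite /AK mulmxDl mulmxA.
apply: le_trans (V_le (v := fun j => K *m z j) _) _; first by rewrite trz.
rewrite /rcost trz; elim: N => [|k IH]; first by rewrite big_ord0 add0r.
apply: le_trans IH; rewrite big_ord_recr /= -addrA lerD2l trz.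
by have [] := terminal (Dz k).
Qed.

Lemma mpc_GAS : GAS A B (fun x => us x 0%N).
Proof.
set kappa := fun x => us x 0%N.
pose cl x0 k := closed_loop A B kappa x0 k.
have Vcl x0 k : V (cl x0 k.+1) <= V (cl x0 k) - l (cl x0 k) (kappa (cl x0 k)).
  exact: V_decrease.
have Vmono x0 k : V (cl x0 k.+1) <= V (cl x0 k).
  by apply: le_trans (Vcl x0 k) _; rewrite gerBl.
split=> [e e0|x0].
  (* [c] bounds the stage cost, hence [V], from below outside the [e]-ball; near 0 one has
     [V <= F < c], and [V] never increases. *)
  have [c c0 lc] := l_pos e0.
  have : \forall x \near (0 : 'cV[R]_n), D x /\ F x < c.
    near=> x; split; first by near: x.
    by near: x; apply: (cvgr_lt _ F_cont0); rewrite F0.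
  move=> /nbhs_ballP[eta /= eta0 etaP]; exists eta; split => // x0 x0eta k.
  have [Dx0 Fx0] : D x0 /\ F x0 < c.
    by apply: etaP; rewrite mx_norm_ball /ball_ /= sub0r normrN.
  have Vk : V (cl x0 k) <= V x0.
    by elim: k => [//|k IH]; exact: le_trans (Vmono x0 k) IH.
  rewrite ltNge; apply/negP => /lc -/(_ (kappa (cl x0 k))) cl_c.
  have := V_ge_stage (cl x0 k); have := V_le_terminal Dx0.
  by rewrite -/(kappa _); lra.
(* [V] converges, so its decrements, which dominate the stage costs, tend to 0; [l_pos] then forces
   the states to 0. *)
have cvV : cvgn (fun k => V (cl x0 k)).
  apply: nonincreasing_is_cvgn.
    by apply/nonincreasing_seqP => k; exact: Vmono.
  by exists 0 => _ [k _ <-]; exact: V_ge0.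
have dV : (V (cl x0 k) - V (cl x0 k.+1)) @[k --> \oo] --> (0 : R).
  rewrite -(subrr (limn (fun k => V (cl x0 k)))); apply: cvgB => //.
  by rewrite (cvg_shiftS (fun k => V (cl x0 k))).
apply/cvgrPdist_lt => e e0; have [c c0 lc] := l_pos e0.
have /cvgrPdist_lt/(_ c c0) := dV; apply: filterS => k.
rewrite !sub0r !normrN => /(le_lt_trans (ler_norm _)) dVk.
rewrite ltNge; apply/negP => /lc -/(_ (kappa (cl x0 k))).
by have := Vcl x0 k; lra.
Unshelve. all: by end_near. Qed.

End stability.

End mpc.

(** * Quadratic forms *)

Section quadratic_form.
Variables (R : realType) (n : nat).

Lemma qfD (Q1 Q2 : 'M[R]_n) x : qf (Q1 + Q2) x = qf Q1 x + qf Q2 x.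
Proof. by rewrite /qf mulmxDr mulmxDl mxE. Qed.

Lemma qfZ (c : R) (Q : 'M[R]_n) x : qf (c *: Q) x = c * qf Q x.
Proof. by rewrite /qf -scalemxAr -scalemxAl mxE. Qed.

Lemma qf_conj (m : nat) (X : 'M[R]_(m, n)) (Q : 'M[R]_m) x :
  qf (X^T *m Q *m X) x = qf Q (X *m x).
Proof. by rewrite /qf trmx_mul !mulmxA. Qed.

Lemma qf0 (Q : 'M[R]_n) : qf Q 0 = 0.
Proof. by rewrite /qf mulmx0 mxE. Qed.

Lemma qf_scale (Q : 'M[R]_n) (t : R) x : qf Q (t *: x) = t ^+ 2 * qf Q x.
Proof.
by rewrite /qf -scalemxAr linearZ /= -!scalemxAl !mxE mulrA expr2.
Qed.

Lemma pd_ge0 (Q : 'M[R]_n) : pd Q -> forall x, 0 <= qf Q x.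
Proof.
move=> [_ Qp] x; case: (eqVneq x 0) => [->|/Qp/ltW//].
by rewrite qf0.
Qed.

Lemma qf_star (Q : 'M[R]_n) : pd Q ->
  forall x (t : R), 0 <= t <= 1 -> qf Q (t *: x) <= t * qf Q x.
Proof.
move=> Qp x t /andP[t0 t1]; rewrite qf_scale expr2 -mulrA.
by rewrite ler_wpM2l// ler_piMl// pd_ge0.
Qed.

End quadratic_form.

(** * Steering to the origin by controllability *)

Section steering.
Variables (R : realType) (n m : nat) (A : 'M[R]_n) (B : 'M[R]_(n, m)).

Lemma trajE (x : 'cV[R]_n) (u : nat -> 'cV[R]_m) k :
  traj A B x u k = A ^+ k *m x + \sum_(i < k) A ^+ (k - i.+1) *m B *m u i.
Proof.
elim: k => [|k IH] /=; first by rewrite big_ord0 addr0 expr0 mul1mx.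
rewrite IH big_ord_recr /= subnn expr0 mul1mx mulmxDr mulmxA exprS -mulmxE addrA.
congr (_ + _ + _); rewrite mulmx_sumr; apply: eq_bigr => i _.
by rewrite subSn ?ltn_ord// exprS -mulmxE !mulmxA.
Qed.

Lemma traj_add (x : 'cV[R]_n) (u : nat -> 'cV[R]_m) a b :
  traj A B x u (a + b) = traj A B (traj A B x u a) (fun k => u (a + k)%N) b.
Proof. by elim: b => [|b IH]; rewrite ?addn0// addnS /= IH. Qed.

(** Full row rank gives the controllability matrix a right inverse, which solves for the stacked
    inputs. *)
Lemma controllable_steer : controllable A B ->
  forall x : 'cV[R]_n, exists u, traj A B x u n = 0.
Proof.
rewrite /controllable; set G := \mxrow_(k < n) _ => rG x.
have [H GH] : exists H, G *m H = 1%:M by apply/row_freeP; rewrite /row_free rG.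
pose w := H *m (- (A ^+ n *m x)).
have Gw : G *m w = - (A ^+ n *m x) by rewrite mulmxA GH mul1mx.
(* Block [k] multiplies the input at time [n - 1 - k], so the blocks of [w] are read in reverse. *)
pose u k : 'cV[R]_m := if insub k is Some i then submxcol w (rev_ord i) else 0.
exists u; rewrite trajE.
have -> : \sum_(i < n) A ^+ (n - i.+1) *m B *m u i = G *m w.
  rewrite -[w]submxcolK mul_mxrow_mxcol.
  rewrite (reindex_inj rev_ord_inj) /=; apply: eq_bigr => i _.
  have -> : (n - (n - i.+1).+1)%N = i := congr1 val (rev_ordK i).
  by rewrite /u -[(n - i.+1)%N]/(val (rev_ord i)) valK rev_ordK.
by rewrite Gw subrr.
Qed.

(** Zero input for [N - n] steps, then steering in [n] steps. *)
Lemma controllable_steer_late (N : nat) : controllable A B -> (n <= N)%N ->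
  forall x : 'cV[R]_n, exists u, traj A B x u N = 0.
Proof.
move=> ctr nN x.
have [v vn] := controllable_steer ctr (traj A B x (fun=> 0) (N - n)).
exists (fun k => if (k < N - n)%N then 0 else v (k - (N - n))%N).
rewrite -[X in traj _ _ _ _ X](subnK nN) traj_add -[RHS]vn.
rewrite (@eq_traj _ _ _ A B x _ (fun=> 0)) => [|j ->//].
by apply: eq_traj => j _; rewrite ltnNge leq_addr /= addKn.
Qed.

End steering.

(** On the boundary this is divergence of [f]; off the closure a neighbourhood avoids [X] and the
    implication is vacuous. *)
Lemma barrier_near_boundary (R : realType) (n : nat) (X : set 'cV[R]_n)
    (f : 'cV[R]_n -> R) :
  (forall y, closure X y -> ~ interior X y ->
     f x @[x --> within (interior X) (nbhs y)] --> +oo) ->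
  forall y, ~ interior X y -> forall b : R,
    \forall x \near y, interior X x -> b < f x.
Proof.
move=> fy y nXy b; have [cy|ncy] := pselect (closure X y).
  by have /cvgryPgt/(_ b) := fy y cy nXy.
have : nbhs y (~` closure X).
  by apply: open_nbhs_nbhs; split => //; exact/closed_openC/closed_closure.
apply: filterS => x ncx Xx; case: ncx; apply: subset_closure.
exact: interior_subset.
Qed.

(** * The relaxed MPC problem as an instance *)

Unset Implicit Arguments.

Theorem theorem3 (R : realType) (n m px pu N : nat)
  (A : 'M[R]_n) (B : 'M[R]_(n, m))
  (Cx : 'M[R]_(px, n)) (dx : 'cV[R]_px) (Cu : 'M[R]_(pu, m)) (du : 'cV[R]_pu)
  (Q : 'M[R]_n) (Rm : 'M[R]_m) (eps : R)
  (rk : relax_kind) (rcx : recenter R px) (rcu : recenter R pu) (delta : R)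
  (K : 'M[R]_(m, n)) (M : 'M[R]_n) (Nset : set 'cV[R]_n) (P : 'M[R]_n)
  (Xf : set 'cV[R]_n) (Bf : 'cV[R]_n -> R) :
  (* system, constraints, cost *)
  controllable A B ->
  (n <= N)%N ->
  (forall i, 0 < dx i ord0) -> (forall j, 0 < du j ord0) ->
  compact (polytope Cx dx) -> compact (polytope Cu du) ->
  psd Q -> pd Rm -> 0 < eps ->
  (* relaxed barrier and recentering *)
  relax_ok rk -> recenter_ok Cx dx rcx -> recenter_ok Cu du rcu ->
  0 < delta ->
  (* admissibility *)
  rbarrier (Bhat rk delta) Cx dx rcx 0 = 0 ->
  rbarrier (Bhat rk delta) Cu du rcu 0 = 0 ->
  (forall v : 'cV[R]_n, is_derive 0 v (rbarrier (Bhat rk delta) Cx dx rcx) 0) ->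
  (forall v : 'cV[R]_m, is_derive 0 v (rbarrier (Bhat rk delta) Cu du rcu) 0) ->
  (* terminal ingredients *)
  schur (A + B *m K) ->
  psd M ->
  cvx_set Nset -> compact Nset -> interior Nset 0 ->
  (forall x, Nset x -> polytope Cx dx x /\ polytope Cu du (K *m x)) ->
  (forall x, Nset x ->
     (forall i, 0 < slack Cx dx x i) /\ (forall j, 0 < slack Cu du (K *m x) j) /\
     rbarrier (@Blog R) Cx dx rcx x + rbarrier (@Blog R) Cu du rcu (K *m x) <= qf M x) ->
  pd P ->
  P = (A + B *m K)^T *m P *m (A + B *m K) + K^T *m Rm *m K + Q + eps *: M ->
  cvx_set Xf -> compact Xf -> Xf 0 -> (forall x, Xf x -> Nset x) ->
  (forall x, Xf x -> Xf ((A + B *m K) *m x)) ->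
  (* recentered barrier B_f for X_f, defined on the interior of X_f *)
  interior Xf 0 ->
  (forall x, interior Xf x -> 0 <= Bf x) ->
  cvx_fun_on (interior Xf) Bf ->
  (forall x, interior Xf x -> differentiable Bf x) ->
  (forall v : 'cV[R]_n, {within interior Xf, continuous (fun x => 'D_v Bf x)}) ->
  Bf 0 = 0 ->
  (forall y, closure Xf y -> ~ interior Xf y ->
     Bf x @[x --> within (interior Xf) (nbhs y)] --> +oo) ->
  (forall x, interior Xf x ->
     interior Xf ((A + B *m K) *m x) /\ Bf ((A + B *m K) *m x) <= Bf x) ->
  (* conclusion: the relaxed MPC problem has an optimal solution for every x,
     and every optimal MPC feedback globally asymptotically stabilizes 0 *)
  (forall x : 'cV[R]_n, exists u : nat -> 'cV[R]_m,
     (J_hat N A B Q Rm eps rk delta Cx dx rcx Cu du rcu P Xf Bf x u < +oo)%E /\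
     forall v, (J_hat N A B Q Rm eps rk delta Cx dx rcx Cu du rcu P Xf Bf x u
                <= J_hat N A B Q Rm eps rk delta Cx dx rcx Cu du rcu P Xf Bf x v)%E)
  /\
  (forall kappa : 'cV[R]_n -> 'cV[R]_m,
     (forall x : 'cV[R]_n, exists u : nat -> 'cV[R]_m, u 0%N = kappa x /\
        forall v, (J_hat N A B Q Rm eps rk delta Cx dx rcx Cu du rcu P Xf Bf x u
                   <= J_hat N A B Q Rm eps rk delta Cx dx rcx Cu du rcu P Xf Bf x v)%E) ->
     GAS A B kappa).
Proof.
move=> ctr nN dx0 du0 cX cU [_ Q0] Rp eps0 rk_ok rcx_ok rcu_ok delta0.
move=> Bx0 Bu0 dBx0 dBu0 _ _ _ _ _ _ NB Pp PE _ _ _ XfN _ int0.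
move=> Bf_ge0 _ Bf_diff _ Bf0 Bf_infty Bf_dec.
set l := stage_hat Q Rm eps rk delta Cx dx rcx Cu du rcu.
pose F x := qf P x + eps * Bf x.
have Bx_ge0 := rbarrier_ge0 dx0 rk_ok rcx_ok delta0 Bx0 dBx0 cX.
have Bu_ge0 := rbarrier_ge0 du0 rk_ok rcu_ok delta0 Bu0 dBu0 cU.
have qR0 := pd_ge0 Rp.
have qP0 := pd_ge0 Pp.
have l_ge0 x u : 0 <= l x u.
  by rewrite !addr_ge0 ?mulr_ge0// ltW.
have F_ge0 x : interior Xf x -> 0 <= F x.
  by move=> /Bf_ge0 ?; rewrite addr_ge0 ?mulr_ge0// ltW.
have feas x : exists u, interior Xf (traj A B x u N).
  by have [u uN] := controllable_steer_late ctr nN x; exists u; rewrite uN.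
have F_cont x : interior Xf x -> {for x, continuous F}.
  move=> /Bf_diff/differentiable_continuous cBf.
  exact: (cvgD (@cvg_qf _ _ _ (nbhs x) _ P _ _ cvg_id) (cvgM (cvg_cst _) cBf)).
split.
  apply: (@mpc_min_exists _ _ _ N A B l (interior Xf) F) => //.
  - move=> z.
    have c1 : fst w @[w --> z] --> z.1 by exact: cvg_fst.
    have c2 : snd w @[w --> z] --> z.2 by exact: cvg_snd.
    have cBx := cvg_comp _ _ c1 (@rbarrier_continuous _ _ _ Cx dx rcx _ _ rk_ok delta0 z.1).
    have cBu := cvg_comp _ _ c2 (@rbarrier_continuous _ _ _ Cu du rcu _ _ rk_ok delta0 z.2).
    exact: (cvgD (cvgD (cvgD (cvg_qf c1) (cvg_qf c2)) (cvgM (cvg_cst eps) cBu))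
                 (cvgM (cvg_cst eps) cBx)).
  (* Coercivity in the input comes from [Rm]; the other terms are nonnegative. *)
  - have qfc : continuous (qf Rm) by move=> u; exact: (@cvg_qf _ _ _ (nbhs u) _ Rm _ _ cvg_id).
    have [c c0 gr] := posdef_linear_growth qfc Rp.2 (qf_star Rp) ltr01.
    exists c => // x u u1; apply: le_trans (gr u u1) _.
    have := mulr_ge0 (ltW eps0) (Bx_ge0 x); have := mulr_ge0 (ltW eps0) (Bu_ge0 u).
    by have := Q0 x; rewrite /l /stage_hat; lra.
  (* As [F >= eps * Bf], it suffices that [Bf] exceeds [b / eps]. *)
  - move=> y ny b; apply: filterS (barrier_near_boundary Bf_infty ny (b / eps)) => x bx Xx.
    have := bx Xx; rewrite ltr_pdivrMr// mulrC /F.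
    by have := qP0 x; lra.
move=> kappa /choice[us usP].
have -> : kappa = fun x => us x 0%N by apply/funext => x; have [] := usP x.
(* With [N = 0] no stage cost bounds [V] from below, but then [n = 0] and the state space is a
   single point. *)
case: (posnP N) => [N0|N_gt0].
  have n0 : n = 0%N by apply/eqP; rewrite -leqn0 -N0.
  have cv0 (x : 'cV[R]_n) : x = 0 by apply/colP => i; have := ltn_ord i; rewrite {2}n0.
  split=> [e e0|x0].
    by exists 1; split => // x0 _ k; rewrite [closed_loop _ _ _ _ _]cv0 normr0.
  rewrite (_ : (fun k => _) = fun=> 0); first exact: cvg_cst.
  by apply/funext => k; exact: cv0.
apply: (@mpc_GAS _ _ _ N A B l (interior Xf) F l_ge0 F_ge0 feas K N_gt0) => //.
(* [Q] is only semidefinite, so the lower bound in the state comes from the state barrier. *)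
- move=> e e0.
  have [c c0 gr] := posdef_linear_growth
    (@rbarrier_continuous _ _ _ Cx dx rcx _ _ rk_ok delta0)
    (rbarrier_pos dx0 rk_ok rcx_ok delta0 Bx0 dBx0 cX)
    (rbarrier_star rk_ok rcx_ok delta0 Bx0) e0.
  exists (eps * (c * e)); first by rewrite !mulr_gt0.
  move=> x u ex.
  have ce : c * e <= rbarrier (Bhat rk delta) Cx dx rcx x.
    by apply: le_trans (gr x ex); rewrite ler_pM2l.
  apply: (le_trans (ler_wpM2l (ltW eps0) ce)).
  have := mulr_ge0 (ltW eps0) (Bu_ge0 u).
  by have := Q0 x; have := qR0 u; rewrite /l /stage_hat; lra.
- by apply: open_nbhs_nbhs; split => //; exact: open_interior.
- exact: F_cont.
- by rewrite /F qf0 Bf0 mulr0 addr0.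
- move=> x Xx; have [XAK BAK] := Bf_dec x Xx; split => //.
  have [sx [su bM]] := NB x (XfN x (interior_subset Xx)).
  have hx := rbarrier_le_Blog rk_ok rcx_ok delta0 sx.
  have hu := rbarrier_le_Blog rk_ok rcu_ok delta0 su.
  (* Only the [P] on the right is expanded: its [eps *: M] term pays for both barriers, the
     remaining terms for the quadratic stage cost and the next terminal cost. *)
  rewrite /F {2}PE !qfD qfZ !qf_conj /l /stage_hat.
  have := ler_wpM2l (ltW eps0) (le_trans (lerD hx hu) bM).
  have := ler_wpM2l (ltW eps0) BAK.
  by lra.
- by move=> x v; have [_] := usP x; exact.
Qed.
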